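(* For all sufficiently large $n$, $ex(n,K_4,B_{4,2})\geq \frac{n^2}{12}-2$; moreover $ex(n,K_4,B_{4,2})\leq \frac{n^2}{9}+o(n^2)$ as $n\to\infty$.
   Context: $B_{4,2}$ denotes the graph consisting of two copies of $K_4$ that share exactly $2$ vertices. A graph is $F$-free if it contains no subgraph isomorphic to $F$. For graphs $T,F$, $ex(n,T,F)$ denotes the maximum number of copies of $T$ in an $F$-free graph on $n$ vertices. *)

(* Defs.v *)
From HB Require Import structures.
From mathcomp Require Import all_boot all_order all_algebra.
From mathcomp Require Import all_classical all_reals all_analysis.

Set Implicit Arguments.
Unset Strict Implicit.
Unset Printing Implicit Defensive.

(* A finite simple graph on V: its edges are two-element subsets of V. *)
Record sgraph (V : finType) := SGraph {
  edges :> {set {set V}};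
  edgesP : [forall e in edges, #|e| == 2] }.

HB.instance Definition _ (V : finType) := [isSub for @edges V].
HB.instance Definition _ (V : finType) := [Finite of sgraph V by <:].

Definition clique_edges (V : finType) (A : {set V}) : {set {set V}} :=
  [set e : {set V} | (e \subset A) && (#|e| == 2)].

Lemma clique_edgesP (V : finType) (A : {set V}) :
  [forall e in clique_edges A, #|e| == 2].
Proof. by apply/forall_inP => e; rewrite inE => /andP[]. Qed.

Lemma setU_edgesP (V : finType) (G H : sgraph V) :
  [forall e in (G : {set {set V}}) :|: H, #|e| == 2].
Proof.
apply/forall_inP => e; rewrite inE => /orP[] he.
- exact: (forall_inP (edgesP G)).
- exact: (forall_inP (edgesP H)).
Qed.

Definition clique_on (V : finType) (A : {set V}) : sgraph V :=
  SGraph (clique_edgesP A).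

Definition graph_union (V : finType) (G H : sgraph V) : sgraph V :=
  SGraph (setU_edgesP G H).

Definition K4 : sgraph 'I_4 := clique_on [set: 'I_4].

(* The copies of K_4 on {0,1,2,3} and {2,3,4,5} share exactly {2,3}. *)
Definition B42 : sgraph 'I_6 :=
  graph_union (clique_on [set i : 'I_6 | (i < 4)%N])
              (clique_on [set i : 'I_6 | (2 <= i)%N]).

Definition edge_image (U V : finType) (f : U -> V) (T : sgraph U) :
    {set {set V}} :=
  [set f @: (e : {set U}) | e in edges T].

(* The subgraphs of G isomorphic to T, not necessarily induced; a subgraph is
   the pair of its vertex set and its edge set, so that embeddings of T with
   the same image are counted once. *)
Definition copies (U V : finType) (T : sgraph U) (G : sgraph V) :
    {set {set V} * {set {set V}}} :=
  [set (f @: [set: U], edge_image f T) |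
    f : {ffun U -> V} & injectiveb f && (edge_image f T \subset edges G)].

Definition graph_free (U V : finType) (F : sgraph U) (G : sgraph V) : bool :=
  copies F G == finset.set0.

Definition ex (n : nat) (U W : finType) (T : sgraph U) (F : sgraph W) : nat :=
  \max_(G : sgraph 'I_n | graph_free F G) #|copies T G|.

(* Main.v *)
Require Import Defs.
From mathcomp Require Import all_boot all_order all_algebra.
From mathcomp Require Import zify ring lra.
(* A graph is B_{4,2}-free iff no two of its 4-cliques share exactly two
   vertices.

   Upper bound. The K_4's on a fixed edge are then linearly many, so by the
   regularity lemma all K_4's can be destroyed by a set D of o(n^2) edges, and
   Turan's theorem gives e(G) <= n^2/3 + o(n^2). Every K_4 contains an edge of
   D. The edges of D lying in at most three K_4's account for at most 3|D|
   cliques. If an edge of D lies in at least four K_4's, these form a book: they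
   share a triangle, and each has three edges lying in no other K_4. Hence there
   are at most e(G)/3 + 3|D| <= n^2/9 + o(n^2) cliques.

   Lower bound. Join k = floor((n+3)/6) disjoint triangles completely to an
   independent set of n - 3k vertices; this gives k(n - 3k) cliques. *)

Set Implicit Arguments.
Unset Strict Implicit.
Unset Printing Implicit Defensive.
Import Order.TTheory GRing.Theory Num.Theory.
Local Open Scope ring_scope.

(** * Conditional averages on a partition and their energy *)

Definition cell_avg (R : realFieldType) (X J : finType) (C : X -> J)
    (f : X -> R) (x : X) : R :=
  (\sum_(y | C y == C x) f y) / #|[pred y | C y == C x]|%:R.

(** [cell_avg] is the conditional expectation given the fibres of [C]; this is its squared L2 norm
    for the counting measure, the unnormalised index of a partition in regularity arguments. *)
Definition energy (R : realFieldType) (X J : finType) (C : X -> J)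
    (f : X -> R) : R :=
  \sum_x cell_avg C f x ^+ 2.

Lemma cell_avg_const (R : realFieldType) (X J : finType) (C : X -> J)
    (f : X -> R) (x y : X) :
  C x = C y -> cell_avg C f x = cell_avg C f y.
Proof. by rewrite /cell_avg => ->. Qed.

Lemma cell_size_gt0 (R : realFieldType) (X J : finType) (C : X -> J) (x : X) :
  0 < #|[pred y | C y == C x]|%:R :> R.
Proof. by rewrite ltr0n; apply/card_gt0P; exists x; rewrite inE. Qed.

(** Averaging is a self-adjoint projection: after exchanging the sums, [f y] meets [h y] once for
    each point of the cell of [y], which cancels the cell size. *)
Lemma sum_cell_avg (R : realFieldType) (X J : finType) (C : X -> J)
    (f h : X -> R) :
  (forall x y, C x = C y -> h x = h y) ->
  \sum_x cell_avg C f x * h x = \sum_x f x * h x.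
Proof.
move=> hC; rewrite /cell_avg.
under eq_bigr => x _ do rewrite -mulrA mulr_suml.
rewrite (exchange_big_dep predT) //=; apply: eq_bigr => y _.
rewrite -mulr_sumr; congr (_ * _).
rewrite (eq_bigr (fun=> #|[pred z | C z == C y]|%:R^-1 * h y)); last first.
  by move=> x /eqP Cxy; rewrite -(hC y x) // Cxy.
rewrite sumr_const -[X in _ *+ X](_ : #|[pred z | C z == C y]| = _); last first.
  by apply: eq_card => z; rewrite !inE eq_sym.
by rewrite -(mulr_natl (_ * _)) mulrA divff ?mul1r // gt_eqF ?cell_size_gt0.
Qed.

(** Pythagoras: the average over [C] is the orthogonal projection of the average over the finer [D],
    so the cross term equals the coarse energy. *)
Lemma energy_refine (R : realFieldType) (X J K : finType) (C : X -> J)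
    (D : X -> K) (f : X -> R) :
  (forall x y, D x = D y -> C x = C y) ->
  energy D f
  = energy C f + \sum_x (cell_avg D f x - cell_avg C f x) ^+ 2.
Proof.
move=> CD; rewrite /energy.
have cross : \sum_x cell_avg D f x * cell_avg C f x = \sum_x cell_avg C f x ^+ 2.
  rewrite sum_cell_avg => [|x y /CD]; last exact: cell_avg_const.
  rewrite -(sum_cell_avg (C := C)) => [|x y]; last exact: cell_avg_const.
  by apply: eq_bigr => x _; rewrite expr2.
under [X in _ = _ + X]eq_bigr => x _ do rewrite sqrrB.
rewrite big_split sumrB /= sumrMnl cross; ring.
Qed.

Lemma cell_avg_ge0 (R : realFieldType) (X J : finType) (C : X -> J)
    (f : X -> R) (x : X) :
  (forall x, 0 <= f x) -> 0 <= cell_avg C f x.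
Proof. by move=> f0; rewrite divr_ge0 ?ler0n ?sumr_ge0. Qed.

Lemma cell_avg_le1 (R : realFieldType) (X J : finType) (C : X -> J)
    (f : X -> R) (x : X) :
  (forall x, f x <= 1) -> cell_avg C f x <= 1.
Proof.
move=> f1; rewrite ler_pdivrMr ?cell_size_gt0 // mul1r -sum1_card natr_sum.
exact: ler_sum.
Qed.

Lemma energy_le (R : realFieldType) (X J : finType) (C : X -> J) (f : X -> R) :
  (forall x, 0 <= f x <= 1) -> energy C f <= #|X|%:R.
Proof.
move=> f01; rewrite -sum1_card natr_sum; apply: ler_sum => x _.
by rewrite exprn_ile1 ?cell_avg_ge0 ?cell_avg_le1 // => y;
  have /andP[] := f01 y.
Qed.

(** * One-sided regularity lemma by energy increment *)

Definition edges_between (V : finType) (e : rel V) (A B : {set V}) : nat :=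
  #|[set p in setX A B | e p.1 p.2]|.

Definition pair_colour (V I : finType) (c : V -> I) (p : V * V) : I * I :=
  (c p.1, c p.2).

Definition edge_ind (R : realFieldType) (V : finType) (e : rel V)
    (p : V * V) : R :=
  (e p.1 p.2)%:R.

Definition colour_class (V I : finType) (c : V -> I) (i : I) : {set V} :=
  [set x | c x == i].

Definition sparse_witness (R : realFieldType) (V I : finType) (e : rel V)
    (eps delta : R) (c : V -> I) (ij : I * I) (W : {set V} * {set V}) : bool :=
  [&& W.1 \subset colour_class c ij.1, W.2 \subset colour_class c ij.2,
      delta * #|colour_class c ij.1|%:R <= #|W.1|%:R,
      delta * #|colour_class c ij.2|%:R <= #|W.2|%:R
    & (edges_between e W.1 W.2)%:R < eps * #|W.1|%:R * #|W.2|%:R].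

(* One-sided regularity: only the lower bound on the densities of large
   subpairs is needed to embed cliques. *)
Definition dense_pair (R : realFieldType) (V I : finType) (e : rel V)
    (eps delta : R) (c : V -> I) (ij : I * I) : bool :=
  ~~ [exists W, sparse_witness e eps delta c ij W].

(** For [delta <= 1], a pair of classes of density below [eps] is its own sparse witness, so this
    set gathers the edges of sparse pairs together with those of irregular ones. *)
Definition irregular_edges (R : realFieldType) (V I : finType) (e : rel V)
    (eps delta : R) (c : V -> I) : {set V * V} :=
  [set p | e p.1 p.2 && ~~ dense_pair e eps delta c (pair_colour c p)].

Lemma edge_ind_ge0_le1 (R : realFieldType) (V : finType) (e : rel V) p :
  0 <= edge_ind R e p <= 1.
Proof. by rewrite /edge_ind; case: (e _ _); rewrite ?lexx ?ler01. Qed.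

Lemma sum_edge_ind (R : realFieldType) (V : finType) (e : rel V)
    (A B : {set V}) :
  \sum_(p in setX A B) edge_ind R e p = (edges_between e A B)%:R.
Proof.
rewrite /edges_between -sum1_card natr_sum.
rewrite [RHS](eq_bigl (fun p => (p \in setX A B) && e p.1 p.2)); last first.
  by move=> p; rewrite inE.
by rewrite big_mkcondr; apply: eq_bigr => p _; rewrite /edge_ind; case: ifP.
Qed.

Lemma setX_colour_class (V I : finType) (c : V -> I) (p : V * V) ij :
  (p \in setX (colour_class c ij.1) (colour_class c ij.2))
  = (pair_colour c p == ij).
Proof. by case: ij => i j; rewrite !inE. Qed.

(** Cut every class along the witnesses. Where a non-dense pair has density at least [2 * eps], its
    witness falls short of that density by at least [eps]. Such pairs cover a share [eps] of
    [V * V], their witnesses a share [delta ^+ 2] of that, and the squared deviation there averages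
    at least [eps ^+ 2]. *)
Lemma energy_increment (R : realFieldType) (V I : finType) (e : rel V)
    (eps delta : R) (c : V -> I) :
  0 < eps -> 0 < delta ->
  3 * eps * #|V|%:R ^+ 2 < #|irregular_edges e eps delta c|%:R ->
  exists c' : V -> I * {set I} * {set I},
    energy (pair_colour c) (edge_ind R e) + eps ^+ 3 * delta ^+ 2 * #|V|%:R ^+ 2
    <= energy (pair_colour c') (edge_ind R e).
Proof.
move=> eps0 delta0 hbad.
pose f := edge_ind R e; pose C := pair_colour c.
pose d := cell_avg C f.
(* The default is reached only at dense pairs, which [irr] excludes from [S]. *)
pose W ij := odflt (set0, set0) [pick W | sparse_witness e eps delta c ij W].
have WP ij : ~~ dense_pair e eps delta c ij -> sparse_witness e eps delta c ij (W ij).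
  rewrite negbK => /existsP[w hw]; rewrite /W; case: pickP => //= none.
  by rewrite none in hw.
(* The new colour of [x] records which witness sets contain it, as first or as second component;
   this makes [S] a union of cells of [C']. *)
pose c' x : I * {set I} * {set I} :=
  (c x, [set j | x \in (W (c x, j)).1], [set i | x \in (W (i, c x)).2]).
exists c'; pose C' := pair_colour c'.
have C'C p q : C' p = C' q -> C p = C q by rewrite /C /pair_colour; case=> -> _ _ ->.
rewrite (energy_refine f C'C) lerD2l.
(* The threshold [2 * eps] leaves a gap of [eps] above the density of a witness, at the cost of
   setting aside at most [2 * eps * #|V| ^ 2] edges. *)
pose irr p := ~~ dense_pair e eps delta c (C p) && (2 * eps <= d p).
pose S := [set p | [&& irr p, p.1 \in (W (C p)).1 & p.2 \in (W (C p)).2]].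
have irrC p q : C p = C q -> irr p = irr q.
  by move=> h; rewrite /irr /d (cell_avg_const _ h) h.
have irr_many : eps * #|V|%:R ^+ 2 <= #|[set p | irr p]|%:R.
  have sub : irregular_edges e eps delta c \subset
     [set p | e p.1 p.2 && (d p < 2 * eps)] :|: [set p | irr p].
    apply/subsetP => p; rewrite !inE /irr => /andP[-> ->] /=.
    by case: ltP.
  have low : #|[set p | e p.1 p.2 && (d p < 2 * eps)]|%:R
              <= 2 * eps * #|V|%:R ^+ 2.
    rewrite -sum1_card natr_sum.
    rewrite (eq_bigl (fun p => e p.1 p.2 && (d p < 2 * eps))); last first.
      by move=> p; rewrite inE.
    rewrite big_mkcond /=.
    rewrite (eq_bigr (fun p => f p * (d p < 2 * eps)%R%:R)); last first.
      move=> p _; rewrite /f /edge_ind; case: (e _ _) => /=; last by rewrite mul0r.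
      by rewrite mul1r; case: ltP.
    (* The cutoff is constant on cells, so the edges may be counted through the cell densities, each
       below [2 * eps]. *)
    rewrite -(sum_cell_avg (C := C)); last first.
      by move=> p q h; rewrite /d (cell_avg_const _ h).
    apply: (@le_trans _ _ (\sum_(p : V * V) 2 * eps)).
      apply: ler_sum => p _; rewrite -/(d p); case: ltP => [h|_].
        by rewrite mulr1 ltW.
      by rewrite mulr0; lra.
    by rewrite sumr_const card_prod -(mulr_natr (2 * eps)) natrM expr2.
  have := subset_leq_card sub; rewrite -(ler_nat R) => h1.
  have [+ _] := leq_card_setU [set p | e p.1 p.2 && (d p < 2 * eps)] [set p | irr p].
  rewrite -(ler_nat R) natrD => h2.
  lra.
have SE ij p0 : C p0 = ij -> irr p0 -> forall g : V * V -> R,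
    \sum_(p in S | C p == ij) g p = \sum_(p in setX (W ij).1 (W ij).2) g p.
  move=> Cp0 irrp0 g; apply: eq_bigl => p; rewrite !inE.
  have /and5P[w1 w2 _ _ _] : sparse_witness e eps delta c ij (W ij).
    by apply: WP; rewrite -Cp0; case/andP: irrp0.
  apply/idP/idP => [/andP[/and3P[_ h1 h2] /eqP <-]|/andP[h1 h2]].
    by rewrite h1 h2.
  have Cp : C p = ij.
    apply/eqP; rewrite -setX_colour_class inE.
    by rewrite (subsetP w1) ?(subsetP w2).
  by rewrite Cp eqxx h1 h2 (irrC p p0) ?irrp0 // Cp.
have S0 ij : (forall p, C p = ij -> ~~ irr p) -> forall g : V * V -> R,
    \sum_(p in S | C p == ij) g p = 0.
  move=> h g; apply: big_pred0 => p; rewrite !inE.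
  by case: eqP; rewrite ?andbF // => Cp; rewrite (negbTE (h p Cp)).
have caseC ij : (exists2 p0, C p0 = ij & irr p0) \/ (forall p, C p = ij -> ~~ irr p).
  case: (pickP [pred p | (C p == ij) && irr p]) => [p /andP[/eqP h1 h2]|h].
    by left; exists p.
  by right => p Cp; have := h p; rewrite /= Cp eqxx /= => ->.
have S_card : delta ^+ 2 * #|[set p | irr p]|%:R <= #|S|%:R.
  rewrite -!sum1_card !natr_sum mulr_sumr.
  rewrite (partition_big C predT) //= [X in _ <= X](partition_big C predT) //=.
  apply: ler_sum => ij _; case: (caseC ij) => [[p0 Cp0 irrp0]|none]; last first.
    rewrite S0 // big_pred0 // => p; rewrite !inE.
    by case: eqP; rewrite ?andbF // => Cp; rewrite (negbTE (none p Cp)).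
  rewrite (SE _ _ Cp0 irrp0).
  have /and5P[_ _ w3 w4 _] : sparse_witness e eps delta c ij (W ij).
    by apply: WP; rewrite -Cp0; case/andP: irrp0.
  rewrite -natr_sum sum1_card cardsX natrM.
  rewrite (eq_bigl (fun p => p \in setX (colour_class c ij.1) (colour_class c ij.2))); last first.
    move=> p; rewrite setX_colour_class inE -/(C p).
    by case: eqP => [Cp|_]; rewrite ?andbF // andbT (irrC p p0) // Cp.
  rewrite -mulr_sumr -natr_sum sum1_card cardsX natrM expr2 mulrACA.
  by rewrite ler_pM // mulr_ge0 // ltW.
have S_dev : \sum_(p in S) (f p - d p) <= - eps * #|S|%:R.
  rewrite -sum1_card natr_sum mulr_sumr.
  rewrite (partition_big C predT) //= [X in _ <= X](partition_big C predT) //=.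
  apply: ler_sum => ij _; case: (caseC ij) => [[p0 Cp0 irrp0]|none]; last first.
    by rewrite !S0.
  rewrite !(SE _ _ Cp0 irrp0).
  have /and5P[w1 w2 _ _ w5] : sparse_witness e eps delta c ij (W ij).
    by apply: WP; rewrite -Cp0; case/andP: irrp0.
  rewrite sumrB sum_edge_ind -mulr_sumr -natr_sum sum1_card cardsX natrM.
  have : 2 * eps * (#|(W ij).1|%:R * #|(W ij).2|%:R)
         <= \sum_(p in setX (W ij).1 (W ij).2) d p.
    rewrite -natrM -cardsX -sum1_card natr_sum mulr_sumr; apply: ler_sum => p.
    rewrite inE => /andP[h1 h2]; rewrite mulr1.
    have Cp : C p = C p0.
      apply/eqP; rewrite Cp0 -setX_colour_class inE.
      by rewrite (subsetP w1) ?(subsetP w2).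
    by case/andP: irrp0; rewrite /d -(cell_avg_const _ Cp).
  rewrite -mulrA in w5; lra.
have S_meas : \sum_(p in S) cell_avg C' f p = \sum_(p in S) f p.
  have indE (g : V * V -> R) :
      \sum_(p in S) g p = \sum_p g p * (p \in S)%:R.
    by rewrite big_mkcond; apply: eq_bigr => p _; rewrite mulr_natr mulrb.
  rewrite !indE; apply: sum_cell_avg => p q h.
  have Cpq := C'C _ _ h; rewrite !inE (irrC _ _ Cpq) Cpq.
  case: q h Cpq => q1 q2; case: p => p1 p2 /= [-> /setP a1 _ -> _ /setP a2] _.
  by have := a1 (c q2); have := a2 (c q1); rewrite !inE => -> ->.
apply: (@le_trans _ _ (eps ^+ 2 * #|S|%:R)).
  apply: (@le_trans _ _ (eps ^+ 2 * (delta ^+ 2 * (eps * #|V|%:R ^+ 2)))).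
    by rewrite le_eqVlt; apply/orP; left; apply/eqP; ring.
  rewrite ler_wpM2l ?sqr_ge0 // (le_trans _ S_card) //.
  by rewrite ler_wpM2l ?sqr_ge0.
apply: (@le_trans _ _ (\sum_(p in S) (cell_avg C' f p - d p) ^+ 2)); last first.
  rewrite [X in _ <= X](bigID (mem S)) /= lerDl sumr_ge0 // => p _.
  exact: sqr_ge0.
(* u^2 >= -2 eps u - eps^2 replaces Cauchy-Schwarz. *)
apply: (@le_trans _ _ (\sum_(p in S)
   (- (2 * eps) * (cell_avg C' f p - d p) - eps ^+ 2))).
  rewrite sumrB -mulr_sumr sumrB S_meas -sumrB sumr_const -mulr_natr.
  nra.
apply: ler_sum => p _.
have := sqr_ge0 (cell_avg C' f p - d p + eps); nra.
Qed.

(** The energy is at most [#|V| ^ 2] and each failure raises it by the fixed share [kappa] of that,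
    so about [kappa^-1] refinements suffice, whatever the graph. *)
Lemma regularity_partition (R : archiRealFieldType) (eps delta : R) :
  0 < eps -> 0 < delta ->
  exists M : nat, forall (V : finType) (e : rel V),
    exists (I : finType) (c : V -> I),
      (#|I| <= M)%N /\
      #|irregular_edges e eps delta c|%:R <= 3 * eps * #|V|%:R ^+ 2.
Proof.
move=> eps0 delta0; pose kappa := eps ^+ 3 * delta ^+ 2.
have kappa0 : 0 < kappa by rewrite mulr_gt0 // exprn_gt0.
(* [t] measures, in increments, the room left below the maximal energy; [k] bounds the current
   number of classes. *)
have iter t : forall k, exists M, forall (V : finType) (e : rel V) (I : finType) (c : V -> I),
    (#|I| <= k)%N ->
    (1 - t%:R * kappa) * #|V|%:R ^+ 2 <= energy (pair_colour c) (edge_ind R e) ->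
    exists (I' : finType) (c' : V -> I'), (#|I'| <= M)%N /\
      #|irregular_edges e eps delta c'|%:R <= 3 * eps * #|V|%:R ^+ 2.
  elim: t => [|t IH] k.
    exists k => V e I c Ik; rewrite mul0r subr0 mul1r => hc.
    exists I, c; split => //; rewrite leNgt; apply/negP => hbad.
    have [c' hc'] := energy_increment eps0 delta0 hbad.
    have := energy_le (pair_colour c') (@edge_ind_ge0_le1 R _ e).
    rewrite card_prod natrM -expr2 => h.
    (* An increment beyond the maximal energy forces [V] to be empty, and then no edge is
       irregular. *)
    have : kappa * #|V|%:R ^+ 2 <= 0 by rewrite /kappa; lra.
    rewrite pmulr_rle0 // => n0.
    have : #|V|%:R ^+ 2 == 0 :> R by rewrite eq_le n0 sqr_ge0.
    rewrite sqrf_eq0 pnatr_eq0 => /eqP V0.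
    move: hbad; rewrite V0 expr0n mulr0 ltr0n card_gt0 => /set0Pn[[x y] _].
    by have := fintype0 x; apply.
  (* A refined colour is an old colour with two sets of old colours. *)
  have [M HM] := IH (k * 2 ^ k * 2 ^ k)%N.
  exists (maxn k M) => V e I c Ik hc.
  case: (leP #|irregular_edges e eps delta c|%:R (3 * eps * #|V|%:R ^+ 2)) => [h|hbad].
    by exists I, c; split => //; rewrite leq_max Ik.
  have [c' hc'] := energy_increment eps0 delta0 hbad.
  have [||I' [c'' [h1 h2]]] := HM V e _ c'.
  - have cardS : #|{: {set I}}| = (2 ^ #|I|)%N.
      by have := card_powerset [set: I]; rewrite powersetT !cardsT.
    by rewrite !card_prod !cardS !leq_mul // leq_exp2l.
  - move: hc; rewrite -[t.+1]addn1 natrD /kappa in hc' *; lra.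
  by exists I', c''; split => //; rewrite leq_max h1 orbT.
(* With [t] above [kappa^-1] the required energy is nonpositive, so the partition into one class
   qualifies. *)
have [M HM] := iter (Num.bound kappa^-1) 1%N.
exists M => V e; have [||I [c hc]] := HM V e unit (fun=> tt).
- by rewrite card_unit.
- apply: (@le_trans _ _ 0); last by rewrite sumr_ge0 // => p _; rewrite sqr_ge0.
  rewrite mulr_le0_ge0 ?sqr_ge0 // subr_le0 -ler_pdivrMr // div1r ltW //.
  by rewrite archi_boundP ?invr_ge0 ?ltW.
by exists I, c.
Qed.

(** * Embedding K_4's into dense pairs *)

Definition nbrs_in (V : finType) (e : rel V) (S : {set V}) (x : V) : {set V} :=
  [set y in S | e x y].

Lemma edges_between_sum (V : finType) (e : rel V) (A B : {set V}) :
  edges_between e A B = (\sum_(x in A) #|nbrs_in e B x|)%N.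
Proof.
rewrite /edges_between -sum1_card.
rewrite (eq_bigl (fun p => (p.1 \in A) && (p.2 \in nbrs_in e B p.1))); last first.
  by move=> [x y]; rewrite !inE /= andbA.
rewrite -(pair_big_dep _ (fun x y => y \in nbrs_in e B x) (fun _ _ => 1%N)) /=.
by apply: eq_bigr => x _; rewrite sum1_card.
Qed.

Lemma dense_pair_edges (R : realFieldType) (V I : finType) (e : rel V)
    (eps delta : R) (c : V -> I) (i j : I) (A B : {set V}) :
  dense_pair e eps delta c (i, j) ->
  A \subset colour_class c i -> B \subset colour_class c j ->
  delta * #|colour_class c i|%:R <= #|A|%:R ->
  delta * #|colour_class c j|%:R <= #|B|%:R ->
  eps * #|A|%:R * #|B|%:R <= (edges_between e A B)%:R.
Proof.
move=> + iA jB hA hB; rewrite /dense_pair negb_exists => /forallP/(_ (A, B)).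
by rewrite /sparse_witness /= iA jB hA hB /= -leNgt.
Qed.

(** Otherwise the low-degree vertices together with [B] would be a sparse witness. *)
Lemma card_low_degree (R : realFieldType) (V I : finType) (e : rel V)
    (eps delta : R) (c : V -> I) (i j : I) (B : {set V}) :
  0 < delta -> dense_pair e eps delta c (i, j) ->
  colour_class c i != set0 -> B \subset colour_class c j ->
  delta * #|colour_class c j|%:R <= #|B|%:R ->
  #|[set x in colour_class c i | #|nbrs_in e B x|%:R < eps * #|B|%:R]|%:R
  < delta * #|colour_class c i|%:R.
Proof.
move=> delta0 dij i0 jB hB; set X := [set x in _ | _]; rewrite ltNge.
apply/negP => hX.
have Xi : X \subset colour_class c i by apply/subsetP => x; rewrite inE => /andP[].
have := dense_pair_edges dij Xi jB hX hB; apply/negP; rewrite -ltNge.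
have /card_gt0P[x0 Xx0] : (0 < #|X|)%N.
  by rewrite -(ltr0n R) (lt_le_trans _ hX) // mulr_gt0 // ltr0n card_gt0.
rewrite edges_between_sum natr_sum mulrAC -mulrC -[X in X%:R * _]sum1_card.
rewrite natr_sum mulr_suml; under [X in _ < X]eq_bigr do rewrite mul1r.
rewrite (bigD1 x0) //= [X in _ < X](bigD1 x0) //= ltr_leD //.
  by move: Xx0; rewrite inE => /andP[].
by apply: ler_sum => x /andP[]; rewrite inE => /andP[_ /ltW].
Qed.

(* v and then w are chosen with large neighbourhoods inside the remaining
   classes, so that quadratically many K_4's contain the single edge vw; in a
   B_{4,2}-free graph an edge lies in linearly many (K4_on_edge). *)
Lemma dense_classes_edge_in_many_K4 (R : realFieldType) (V I : finType)
    (e : rel V) (eps : R) (c : V -> I) (i j k l : I) :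
  0 < eps -> 4 * eps <= 1 ->
  colour_class c i != set0 -> colour_class c j != set0 ->
  all (dense_pair e eps (eps ^+ 2) c)
    [:: (i, j); (i, k); (i, l); (j, k); (j, l); (k, l)] ->
  exists v w : V, e v w /\
    eps ^+ 5 * #|colour_class c k|%:R * #|colour_class c l|%:R
    <= #|[set p | [&& e v p.1, e v p.2, e w p.1, e w p.2 & e p.1 p.2]]|%:R.
Proof.
move=> eps0 eps4 i0 j0 /and5P[dij dik dil djk /andP[djl /andP[dkl _]]].
set A := colour_class c i in i0 *; set B := colour_class c j in j0 *.
set K := colour_class c k; set L := colour_class c l.
have d0 : 0 < eps ^+ 2 by rewrite exprn_gt0.
have d_eps : 4 * eps ^+ 2 <= eps by rewrite expr2 mulrA -[leRHS]mul1r ler_pM2r.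
have full (S : {set V}) : eps ^+ 2 * #|S|%:R <= #|S|%:R.
  by rewrite ler_piMl // (le_trans (y := eps)); lra.
have shrink (S T : {set V}) a : eps * a <= #|T|%:R -> 0 <= a -> eps ^+ 2 * a <= #|T|%:R.
  move=> h a0; apply: le_trans h; rewrite ler_wpM2r //; lra.
have nbrsS S x : nbrs_in e S x \subset S by apply/subsetP => y; rewrite inE => /andP[].
have A0 : 0 < #|A|%:R :> R by rewrite ltr0n card_gt0.
have B0 : 0 < #|B|%:R :> R by rewrite ltr0n card_gt0.
(* Three exceptional sets of fewer than [eps ^+ 2 * #|A|] vertices each cannot cover [A]. *)
have [v [vB vK vL]] : exists v, [/\ eps * #|B|%:R <= #|nbrs_in e B v|%:R,
    eps * #|K|%:R <= #|nbrs_in e K v|%:R & eps * #|L|%:R <= #|nbrs_in e L v|%:R].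
  have hB := card_low_degree d0 dij i0 (subxx _) (full _).
  have hK := card_low_degree d0 dik i0 (subxx _) (full _).
  have hL := card_low_degree d0 dil i0 (subxx _) (full _).
  rewrite -/A -/B -/K -/L in hB hK hL.
  move: hB hK hL; set XB := [set x in A | _]; set XK := [set x in A | _].
  set XL := [set x in A | _] => hB hK hL.
  have : ~~ (A \subset XB :|: XK :|: XL).
    apply/negP => /subset_leq_card; rewrite -(ler_nat R) => h.
    have [h1 _] := leq_card_setU (XB :|: XK) XL.
    have [h2 _] := leq_card_setU XB XK.
    rewrite -(ler_nat R) natrD in h1; rewrite -(ler_nat R) natrD in h2.
    have : 4 * eps ^+ 2 * #|A|%:R <= #|A|%:R by rewrite ler_piMl //; lra.
    have : 0 < eps ^+ 2 * #|A|%:R by rewrite mulr_gt0.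
    lra.
  case/subsetPn => v; rewrite !inE => -> /norP[/norP[]] /=.
  by rewrite -!leNgt => *; exists v.
have K'e : eps ^+ 2 * #|K|%:R <= #|nbrs_in e K v|%:R by apply: shrink.
have L'e : eps ^+ 2 * #|L|%:R <= #|nbrs_in e L v|%:R by apply: shrink.
(* [v] has at least [eps * #|B| >= 4 * eps ^+ 2 * #|B|] neighbours in [B], more than two exceptional
   sets can cover. *)
have [w [wv wK wL]] : exists w, [/\ e v w,
    eps * #|nbrs_in e K v|%:R <= #|nbrs_in e (nbrs_in e K v) w|%:R
    & eps * #|nbrs_in e L v|%:R <= #|nbrs_in e (nbrs_in e L v) w|%:R].
  have hK := card_low_degree d0 djk j0 (nbrsS _ _) K'e.
  have hL := card_low_degree d0 djl j0 (nbrsS _ _) L'e.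
  rewrite -/B in hK hL.
  move: hK hL; set XK := [set x in B | _].
  set XL := [set x in B | _] => hK hL.
  have : ~~ (nbrs_in e B v \subset XK :|: XL).
    apply/negP => /subset_leq_card; rewrite -(ler_nat R) => h.
    have [h2 _] := leq_card_setU XK XL.
    rewrite -(ler_nat R) natrD in h2.
    have : 4 * eps ^+ 2 * #|B|%:R <= eps * #|B|%:R by rewrite ler_pM2r.
    have : 0 < eps ^+ 2 * #|B|%:R by rewrite mulr_gt0.
    lra.
  case/subsetPn => w; rewrite !inE => /andP[-> evw] /=.
  by rewrite negb_or -!leNgt => /andP[]; exists w.
set K2 := nbrs_in e _ w in wK; set L2 := nbrs_in e _ w in wL.
have K2e : eps ^+ 2 * #|K|%:R <= #|K2|%:R.
  by rewrite expr2 -mulrA (le_trans _ wK) // ler_pM2l.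
have L2e : eps ^+ 2 * #|L|%:R <= #|L2|%:R.
  by rewrite expr2 -mulrA (le_trans _ wL) // ler_pM2l.
exists v, w; split => //.
apply: (@le_trans _ _ (edges_between e K2 L2)%:R); last first.
  rewrite ler_nat subset_leq_card //; apply/subsetP => -[x y]; rewrite !inE /=.
  by case/andP => /andP[/andP[/andP[_ ->] ->] /andP[/andP[_ ->] ->]] ->.
have := dense_pair_edges dkl (subset_trans (nbrsS _ _) (nbrsS _ _))
  (subset_trans (nbrsS _ _) (nbrsS _ _)) K2e L2e.
(* Both [K] and [L] have shrunk twice by a factor [eps]; the fifth factor is the density between the
   remaining sets. *)
apply: le_trans; rewrite (_ : eps ^+ 5 * _ * _ =
  eps * (eps ^+ 2 * #|K|%:R * (eps ^+ 2 * #|L|%:R))); last by ring.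
by rewrite -[X in _ <= X]mulrA ler_pM2l // ler_pM // mulr_ge0 // ltW.
Qed.

(** * Destroying all 4-cliques with few edges *)

Definition cliques4 (V : finType) (e : rel V) : {set {set V}} :=
  [set A : {set V} | (#|A| == 4)
     && [forall x in A, forall y in A, (x != y) ==> e x y]].

Definition no_2_overlap (V : finType) (F : {set {set V}}) : bool :=
  [forall A in F, forall B in F, #|A :&: B| != 2].

Lemma no_2_overlapP (V : finType) (F : {set {set V}}) (A B : {set V}) :
  no_2_overlap F -> A \in F -> B \in F -> #|A :&: B| <> 2%N.
Proof. by move=> /forall_inP h /h /forall_inP h' /h' /eqP. Qed.

Lemma cliques4_quad (V : finType) (e : rel V) (a b c d : V) :
  symmetric e -> irreflexive e ->
  e a b -> e a c -> e a d -> e b c -> e b d -> e c d ->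
  [set a; b; c; d] \in cliques4 e.
Proof.
move=> sym irr ab ac ad bc bd cd.
have ne x y : e x y -> x != y by apply: contraTneq => ->; rewrite irr.
rewrite inE; apply/andP; split.
  rewrite (_ : [set a; b; c; d] = [set x in [:: a; b; c; d]]); last first.
    by apply/setP => x; rewrite !inE -!orbA.
  rewrite cardsE (card_uniqP _) //= !inE !negb_or !ne //.
apply/forall_inP => x; rewrite !inE => hx; apply/forall_inP => y; rewrite !inE => hy.
apply/implyP; move: hx hy.
by case/orP=> [/orP[/orP[]|]|] /eqP ->; case/orP=> [/orP[/orP[]|]|] /eqP ->;
  rewrite ?eqxx // sym.
Qed.

Lemma card4_quad (V : finType) (A : {set V}) :
  #|A| = 4%N -> exists a b c d, uniq [:: a; b; c; d] /\ A = [set a; b; c; d].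
Proof.
rewrite cardE; case E : (enum A) => [|a [|b [|c [|d [|? ?]]]]] // _.
exists a, b, c, d; rewrite -E enum_uniq; split=> //.
by apply/setP => x; rewrite -mem_enum E !inE -!orbA.
Qed.

Lemma cliques4_adj (V : finType) (e : rel V) (A : {set V}) (x y : V) :
  A \in cliques4 e -> x \in A -> y \in A -> x != y -> e x y.
Proof.
by rewrite inE => /andP[_ /forall_inP h] /h /forall_inP h' /h' /implyP.
Qed.

Lemma cliques4_card (V : finType) (e : rel V) (A : {set V}) :
  A \in cliques4 e -> #|A| = 4%N.
Proof. by rewrite inE => /andP[/eqP]. Qed.

(** Fix one clique [v w q1 q2]. Any other pair completing [vw] must meet [{q1, q2}], or the two
    cliques would share exactly [v] and [w]. *)
Lemma K4_on_edge (V : finType) (e : rel V) (v w : V) :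
  symmetric e -> irreflexive e -> no_2_overlap (cliques4 e) -> e v w ->
  (#|[set p | [&& e v p.1, e v p.2, e w p.1, e w p.2 & e p.1 p.2]]|
   <= 4 * #|V|)%N.
Proof.
move=> sym irr ov vw; set X := [set p | _].
have [->|[[q1 q2]]] := set_0Vmem X; first by rewrite cards0.
rewrite inE /= => /and5P[vq1 vq2 wq1 wq2 q12].
have sub : X \subset setX [set q1; q2] setT :|: setX setT [set q1; q2].
  apply/subsetP => -[p1 p2]; rewrite !inE /= andbT => /and5P[vp1 vp2 wp1 wp2 p12].
  apply: contraT => /norP[/norP[n11 n12] /norP[n21 n22]].
  case: (no_2_overlapP ov (cliques4_quad sym irr vw vp1 vp2 wp1 wp2 p12)
     (cliques4_quad sym irr vw vq1 vq2 wq1 wq2 q12)).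
  have -> : [set v; w; p1; p2] :&: [set v; w; q1; q2] = [set v; w].
    apply/setP => x; rewrite !inE.
    case: (x =P v) => [//|_]; case: (x =P w) => [//|_] /=.
    case: (x =P p1) => [->|_]; first by rewrite (negbTE n11) (negbTE n12).
    by case: (x =P p2) => [->|//]; rewrite (negbTE n21) (negbTE n22).
  rewrite cards2; have : v != w by apply: contraTneq vw => ->; rewrite irr.
  by move=> ->.
apply: leq_trans (subset_leq_card sub) _.
apply: leq_trans (leq_card_setU _ _).1 _.
rewrite !cardsX !cardsT mulnC addnn -mul2n (_ : 4 = 2 * 2)%N // -mulnA.
by rewrite leq_pmul2l // mulnC leq_mul2r cards2; case: (_ != _); rewrite orbT.
Qed.

(** [D] holds the irregular edges and the pairs touching a small class. A clique avoiding [D] has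
    dense pairs and large classes, which puts quadratically many cliques on one edge, against
    [K4_on_edge]. *)
Lemma K4_hitting_set (R : archiRealFieldType) (eps : R) :
  0 < eps ->
  exists N : nat, forall (V : finType) (e : rel V),
    (N <= #|V|)%N -> symmetric e -> irreflexive e ->
    no_2_overlap (cliques4 e) ->
    exists D : {set V * V},
      [/\ #|D|%:R <= eps * #|V|%:R ^+ 2,
          forall x y, ((x, y) \in D) = ((y, x) \in D)
        & forall A, A \in cliques4 e ->
            exists x y, [/\ x \in A, y \in A, x != y & (x, y) \in D]].
Proof.
(* The symmetrised [D] will have at most [8 * a * #|V| ^ 2] pairs; [a <= 1 / 4] is for the
   embedding. *)
move=> eps_gt0; pose a := Num.min (eps / 8) (1 / 4).
have a0 : 0 < a by rewrite /a lt_min; apply/andP; split; lra.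
have a8 : 8 * a <= eps by rewrite mulrC -ler_pdivlMr // /a ge_min lexx.
have a4 : 4 * a <= 1 by rewrite mulrC -ler_pdivlMr // /a ge_min lexx orbT.
have [M HM] := regularity_partition a0 (exprn_gt0 2 a0).
(* At most [M] small classes of fewer than [b * #|V|] vertices then hold at most [a / 2 * #|V|]
   vertices. *)
pose b := a / (2 * M.+1%:R).
have M0 : 0 < M.+1%:R :> R by rewrite ltr0n.
have b0 : 0 < b by rewrite divr_gt0 // mulr_gt0.
pose K := a ^+ 5 * b ^+ 2.
have K0 : 0 < K by rewrite mulr_gt0 // exprn_gt0.
exists (Num.bound (4 / K)).+1 => V e hn sym irr ov.
have [I [c [cI cbad]]] := HM V e.
(* This makes the embedding bound [K * #|V| ^ 2] exceed the bound [4 * #|V|] of [K4_on_edge]. *)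
have nK : 4 < K * #|V|%:R.
  rewrite mulrC -ltr_pdivrMr //; apply: lt_trans (archi_boundP _) _.
    by rewrite divr_ge0 // ltW.
  by rewrite ltr_nat.
have n0 : 0 < #|V|%:R :> R by rewrite ltr0n (leq_trans _ hn).
pose small x := #|colour_class c (c x)|%:R < b * #|V|%:R.
pose S := [set x | small x].
have S_le : #|S|%:R <= a / 2 * #|V|%:R.
  rewrite -sum1_card (partition_big c predT) //= natr_sum.
  apply: (@le_trans _ _ (\sum_(i : I) b * #|V|%:R)).
    apply: ler_sum => i _; rewrite sum1_card.
    case: (pickP [pred x in S | c x == i]) => [x /andP[]|none]; last first.
      rewrite (eq_card none) card0 mulr_ge0 // ltW //.
    rewrite inE => /ltW sx /eqP cx; apply: le_trans sx.
    rewrite ler_nat subset_leq_card //; apply/subsetP => y.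
    by rewrite !inE cx => /andP[].
  rewrite sumr_const -(mulr_natl (b * _)) mulrA ler_wpM2r ?(ltW n0) //.
  have -> : a / 2 = M.+1%:R * b.
    by rewrite /b; move: M.+1%:R M0 => m m0; field; rewrite gt_eqF.
  by rewrite ler_pM2r // ler_nat ltnW.
pose D0 := irregular_edges e a (a ^+ 2) c :|: (setX S setT :|: setX setT S).
pose D := D0 :|: [set p | (p.2, p.1) \in D0].
exists D; split.
(* Irregular edges contribute [3 * a], the two strips at [S] contribute [a / 2] each. *)
- have D0_le : #|D0|%:R <= 4 * a * #|V|%:R ^+ 2.
    have [h1 _] := leq_card_setU (irregular_edges e a (a ^+ 2) c)
      (setX S setT :|: setX setT S).
    have [h2 _] := leq_card_setU (setX S (setT : {set V})) (setX (setT : {set V}) S).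
    rewrite -/D0 -(ler_nat R) natrD in h1.
    rewrite !cardsX !cardsT -(ler_nat R) natrD !natrM in h2.
    have : #|S|%:R * #|V|%:R <= a / 2 * #|V|%:R * #|V|%:R :> R by rewrite ler_pM2r.
    rewrite expr2 in cbad *; lra.
  have [h _] := leq_card_setU D0 [set p | (p.2, p.1) \in D0].
  have hs : #|[set p | (p.2, p.1) \in D0]| = #|D0|.
    have swapK : involutive (fun p : V * V => (p.2, p.1)) by case.
    rewrite -(card_imset D0 (inv_inj swapK)); congr #|pred_of_set _|.
    apply/setP => p; rewrite inE; apply/idP/imsetP => [h'|[q q0 ->]]; last by case: q q0.
    by exists (p.2, p.1) => //; case: p h'.
  rewrite -/D hs -(ler_nat R) natrD in h.
  apply: le_trans h _.
  have : 8 * a * #|V|%:R ^+ 2 <= eps * #|V|%:R ^+ 2 by rewrite ler_wpM2r // sqr_ge0.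
  lra.
- by move=> x y; rewrite !inE /= orbC.
move=> A cA; case: (boolP [exists x in A, exists y in A, (x != y) && ((x, y) \in D)]).
  by case/exists_inP => x xA /exists_inP[y yA /andP[]]; exists x, y.
move/exists_inPn => h; exfalso.
have dense x y : x \in A -> y \in A -> x != y ->
    [/\ ~~ small x, ~~ small y & dense_pair e a (a ^+ 2) c (c x, c y)].
  move=> xA yA xy; have exy := cliques4_adj cA xA yA xy.
  have /exists_inPn/(_ y yA) := h x xA; rewrite xy /= !in_setU !negb_or.
  by rewrite !inE /= exy !andbT /= => /andP[/and3P[/negPn ? ? ?] _].
have [x1 [x2 [x3 [x4 [U EA]]]]] := card4_quad (cliques4_card cA).
move: U; rewrite /= !inE !negb_or !andbT => /and3P[/and3P[n12 n13 n14] /andP[n23 n24] n34].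
have [i1 i2 i3 i4] : [/\ x1 \in A, x2 \in A, x3 \in A & x4 \in A].
  by rewrite EA !inE !eqxx ?orbT.
have [s1 s2 d12] := dense _ _ i1 i2 n12.
have [s3 s4 d34] := dense _ _ i3 i4 n34.
have [_ _ d13] := dense _ _ i1 i3 n13; have [_ _ d14] := dense _ _ i1 i4 n14.
have [_ _ d23] := dense _ _ i2 i3 n23; have [_ _ d24] := dense _ _ i2 i4 n24.
(* The colours of the four vertices may coincide: a class paired with itself is treated like any
   other pair. *)
have ne0 x : colour_class c (c x) != set0 by apply/set0Pn; exists x; rewrite inE.
have [|v [w [evw]]] := dense_classes_edge_in_many_K4 a0 a4 (ne0 x1) (ne0 x2)
  (k := c x3) (l := c x4) (e := e); first by rewrite /= d12 d13 d14 d23 d24 d34.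
apply/negP; rewrite -ltNge.
have := K4_on_edge sym irr ov evw; rewrite -(ler_nat R) natrM => /le_lt_trans; apply.
apply: (@lt_le_trans _ _ (K * #|V|%:R * #|V|%:R)); first by rewrite ltr_pM2r.
rewrite (_ : K * _ * _ = a ^+ 5 * ((b * #|V|%:R) * (b * #|V|%:R))); last by rewrite /K; ring.
rewrite -[X in _ <= X]mulrA ler_pM2l ?exprn_gt0 //.
have bn0 : 0 <= b * #|V|%:R by rewrite mulr_ge0 // ltW.
by apply: ler_pM => //; rewrite leNgt; [exact: s3 | exact: s4].
Qed.

Local Close Scope ring_scope.

(** * Turan's bound for K_4-free graphs *)

Lemma edges_betweenC (V : finType) (e : rel V) (A B : {set V}) :
  symmetric e -> edges_between e A B = edges_between e B A.
Proof.
move=> sym; pose sw (p : V * V) := (p.2, p.1).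
have swK : involutive sw by case.
rewrite /edges_between -(card_imset _ (inv_inj swK)); congr #|pred_of_set _|.
apply/setP => -[x y]; apply/imsetP/idP => [[[u v] + [-> ->]]|].
  by rewrite !inE /= sym (andbC (u \in A)).
by exists (y, x) => //; move: H; rewrite !inE /= sym (andbC (y \in A)).
Qed.

(* Erdos' proof of Turan's theorem: v has maximal degree in S. *)
Lemma edges_in_max_nbrs (V : finType) (e : rel V) (S : {set V}) :
  symmetric e -> S != set0 ->
  exists v, [/\ v \in S, #|nbrs_in e S v| <= #|S| &
    edges_between e S S <= edges_between e (nbrs_in e S v) (nbrs_in e S v)
      + 2 * ((#|S| - #|nbrs_in e S v|) * #|nbrs_in e S v|)].
Proof.
move=> sym /set0Pn[x0 x0S].
case: (arg_maxnP (fun x => #|nbrs_in e S x|) x0S) => v vS vmax.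
have NS : nbrs_in e S v \subset S by apply/subsetP => y; rewrite inE => /andP[].
exists v; split=> //; first exact: subset_leq_card.
set N := nbrs_in e S v in NS vmax *.
have split_deg (B : {set V}) x : B \subset S ->
    #|nbrs_in e S x| = #|nbrs_in e B x| + #|nbrs_in e (S :\: B) x|.
  move=> BS; rewrite -(cardsID B (nbrs_in e S x)); congr (_ + _).
    congr #|pred_of_set _|; apply/setP => y; rewrite !inE.
    by case: (boolP (y \in B)) => [/(subsetP BS) ->|_]; rewrite ?andbT ?andbF.
  by congr #|pred_of_set _|; apply/setP => y; rewrite !inE andbA.
(* Taken with [T = N] for the edges from [N] to the rest, and with [T = S] for all those starting
   outside [N]. *)
have outer (T : {set V}) : T \subset S -> \sum_(x in S :\: N) #|nbrs_in e T x| <= (#|S| - #|N|) * #|N|.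
  move=> TS; have -> : #|S| - #|N| = #|S :\: N| by rewrite cardsD (setIidPr NS).
  rewrite -sum_nat_const; apply: leq_sum => x.
  rewrite inE => /andP[_ xS]; apply: leq_trans (vmax x xS).
  by apply: subset_leq_card; apply/subsetP => y; rewrite !inE => /andP[/(subsetP TS) -> ->].
rewrite edges_between_sum (big_setID N) /= (setIidPr NS).
under eq_bigr => x _ do rewrite (split_deg N) //.
rewrite big_split /= -!edges_between_sum.
rewrite (edges_betweenC N) // edges_between_sum.
have := outer N NS; have := outer S (subxx S).
rewrite -!edges_between_sum; lia.
Qed.

(** Pass to the neighbourhood of a vertex of maximal degree twice; what remains spans no edge.
    Ordered pairs are counted, so the bound amounts to [n ^ 2 / 3] edges. *)
Lemma turan_K4_free (V : finType) (e : rel V) :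
  symmetric e ->
  (forall a b c d, e a b -> e a c -> e a d -> e b c -> e b d -> e c d -> False) ->
  3 * edges_between e setT setT <= 2 * #|V| ^ 2.
Proof.
move=> sym free.
have empty : edges_between e (set0 : {set V}) set0 = 0 by rewrite edges_between_sum big_set0.
have [V0|ne] := eqVneq (setT : {set V}) set0; first by rewrite V0 empty.
have [v [_ nv Ev]] := edges_in_max_nbrs sym ne.
rewrite cardsT in nv Ev; set N := nbrs_in e setT v in nv Ev.
have [N0|neN] := eqVneq N set0.
  by move: Ev; rewrite N0 empty cards0; lia.
have [w [wN nw Ew]] := edges_in_max_nbrs sym neN.
have E0 : edges_between e (nbrs_in e N w) (nbrs_in e N w) = 0.
  apply/eqP; rewrite cards_eq0; apply/eqP/setP => -[x y]; rewrite !inE /=.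
  apply/negP => /andP[/andP[/andP[vx wx] /andP[vy wy]] xy].
  by apply: (free v w x y) => //; move: wN; rewrite inE => /andP[].
rewrite E0 in Ew.
move: (#|nbrs_in _ _ _|) nw Ew => b nw Ew; move: #|N| nv Ev nw Ew => a nv Ev nw Ew.
move: #|V| nv Ev => n nv Ev.
have : 3 * ((n - a) * a) * 2 + 3 * ((a - b) * b) * 2 <= 2 * n ^ 2.
  have [k ->] : exists k, n = a + k by exists (n - a); lia.
  have [l ->] : exists l, a = b + l by exists (a - b); lia.
  (* With [a = b + l] and [n = a + k], four times [n ^ 2 - 3 k a - 3 l b] is
     [(2 k - a) ^ 2 + 3 (b - l) ^ 2]. *)
  rewrite !addKn; have := sqr_ge0 (2 * k%:Z - (b + l)%:Z)%R; have := sqr_ge0 (b%:Z - l%:Z)%R.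
  nia.
lia.
Qed.

(** * Private edges and the number of cliques *)

Definition private_pairs (V : finType) (F : {set {set V}}) (Q : {set V}) :
    {set V * V} :=
  [set p | [&& p.1 \in Q, p.2 \in Q, p.1 != p.2
     & [forall Q' in F, (p.1 \in Q') && (p.2 \in Q') ==> (Q' == Q)]]].

(** The overlap has at least two elements, not exactly two, and not four since the cliques
    differ. *)
Lemma overlap_pair_card3 (V : finType) (F : {set {set V}}) (A B : {set V}) x y :
  no_2_overlap F -> (forall Q, Q \in F -> #|Q| = 4) -> A \in F -> B \in F ->
  A != B -> x != y -> x \in A -> y \in A -> x \in B -> y \in B -> #|A :&: B| = 3.
Proof.
move=> ov F4 AF BF AB xy xA yA xB yB.
have h2 : 2 <= #|A :&: B|.
  rewrite -[2]/(true.+1) -xy -cards2 subset_leq_card //; apply/subsetP => z.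
  by rewrite !inE => /orP[] /eqP ->; rewrite ?xA ?xB ?yA ?yB.
have h4 : #|A :&: B| < 4.
  rewrite -(F4 A AF) ltn_neqAle subset_leq_card ?subsetIl // andbT.
  apply: contraNneq AB => h.
  have /eqP AIB : A :&: B == A by rewrite eqEcard subsetIl h leqnn.
  by rewrite eqEcard -{1}AIB subsetIr (F4 _ AF) (F4 _ BF).
have := no_2_overlapP ov AF BF; lia.
Qed.

Lemma cardsD1_pred (V : finType) (A : {set V}) (a : V) :
  a \in A -> #|A :\ a| = #|A|.-1.
Proof. by move=> aA; rewrite (cardsD1 a A) aA. Qed.

(* If two further cliques contain the same triangle T of Q, then the edges
   joining T to the fourth vertex of Q are private. *)
Lemma page_edges_private (V : finType) (F : {set {set V}}) (Q Q1 Q2 T : {set V}) :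
  no_2_overlap F -> (forall Q, Q \in F -> #|Q| = 4) ->
  Q \in F -> Q1 \in F -> Q2 \in F -> Q1 != Q -> Q2 != Q -> Q1 != Q2 ->
  Q :&: Q1 = T -> Q :&: Q2 = T -> #|T| = 3 -> 6 <= #|private_pairs F Q|.
Proof.
move=> ov F4 QF Q1F Q2F n1 n2 n12 T1 T2 cT.
have TQ : T \subset Q by rewrite -T1 subsetIl.
have TQ1 : T \subset Q1 by rewrite -T1 subsetIr.
have TQ2 : T \subset Q2 by rewrite -T2 subsetIr.
have [p Ep] : exists p, Q :\: T = [set p].
  by apply/cards1P; rewrite cardsD (setIidPr TQ) (F4 _ QF) cT.
have [pQ pT] : p \in Q /\ p \notin T.
  by have := set11 p; rewrite -Ep inE => /andP[].
have Tcap : Q1 :&: Q2 = T.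
  apply/esym/eqP; rewrite eqEcard subsetI TQ1 TQ2 cT /=.
  have : #|Q1 :&: Q2| < 4; last by rewrite ltnS.
  rewrite -(F4 Q1 Q1F) ltn_neqAle subset_leq_card ?subsetIl // andbT.
  apply: contraNneq n12 => h.
  have /eqP AIB : Q1 :&: Q2 == Q1 by rewrite eqEcard subsetIl h leqnn.
  by rewrite eqEcard -{1}AIB subsetIr (F4 _ Q1F) (F4 _ Q2F).
have notin_page Q' : Q :&: Q' = T -> p \notin Q'.
  by move=> h; apply: contra pT => pQ'; rewrite -h inE pQ.
(* A second clique [Q'] through [p] and [u] meets [Q] in three vertices, hence [T] in two. So it
   meets both [Q1] and [Q2] in three vertices, none of them [p]; thus [Q' :\ p] lies in
   [Q1 :&: Q2 = T], and [Q' = Q]. *)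
have uniq_page u Q' : u \in T -> Q' \in F -> p \in Q' -> u \in Q' -> Q' = Q.
  move=> uT Q'F pQ' uQ'; apply/eqP; apply: contraTT isT => nQ'.
  have pu : p != u by apply: contraNneq pT => ->.
  have c3 : #|Q' :&: Q| = 3.
    by apply: (overlap_pair_card3 ov F4 Q'F QF nQ' pu) => //; apply: (subsetP TQ).
  have cT2 : #|Q' :&: T| = 2.
    have : Q' :&: Q :\ p = Q' :&: T.
      apply/setP => z; have := in_setD Q T z; rewrite Ep !inE => ->.
      case: (boolP (z \in T)) => [/(subsetP TQ) ->|_] /=; first by rewrite andbT.
      by case: (z \in Q); rewrite /= !andbF.
    by move=> <-; rewrite cardsD1_pred ?c3 // inE pQ' pQ.
  have /eqP/cards2P[x [y [xy Exy]]] := cT2.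
  have sub i : i \in [set Q1; Q2] -> Q' :\ p \subset i.
    move=> hi; have [iF Ti pi] : [/\ i \in F, T \subset i & p \notin i].
      by move: hi; rewrite !inE => /orP[] /eqP ->; split=> //; apply: notin_page.
    have [/setIP[xQ' xT] /setIP[yQ' yT]] : x \in Q' :&: T /\ y \in Q' :&: T.
      by rewrite Exy !inE !eqxx orbT.
    have ni : Q' != i by apply: contraNneq pi => <-.
    have := overlap_pair_card3 ov F4 Q'F iF ni xy xQ' yQ' (subsetP Ti _ xT) (subsetP Ti _ yT).
    have le : Q' :&: i \subset Q' :\ p.
      apply/subsetP => z; rewrite !inE => /andP[-> zi]; rewrite andbT.
      by apply: contraNneq pi => <-.
    move=> c; have /eqP <- : Q' :&: i == Q' :\ p; last exact: subsetIr.
    by rewrite eqEcard le c cardsD1_pred // (F4 _ Q'F).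
  have subT : Q' :\ p \subset T by rewrite -Tcap subsetI !sub // !inE eqxx ?orbT.
  have ET : Q' :\ p = T.
    by apply/eqP; rewrite eqEcard subT cT cardsD1_pred // (F4 _ Q'F).
  have : Q' \subset Q.
    rewrite -(setD1K pQ') ET subUset TQ andbT sub1set //.
  by move=> s; move: nQ'; rewrite eqEcard s (F4 _ Q'F) (F4 _ QF).
have priv u : u \in T -> (p, u) \in private_pairs F Q /\ (u, p) \in private_pairs F Q.
  move=> uT; rewrite !inE /= pQ (subsetP TQ _ uT).
  have pu : p != u by apply: contraNneq pT => ->.
  rewrite pu eq_sym pu /=; split; apply/forall_inP => Q' Q'F; apply/implyP => /andP[h1 h2];
  by apply/eqP; apply: uniq_page uT Q'F _ _.
(* Each of the three edges from [p] to [T] counts as two ordered pairs, whence 6. *)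
have sub : [set (p, u) | u in T] :|: [set (u, p) | u in T] \subset private_pairs F Q.
  by apply/subsetP => z; rewrite inE => /orP[] /imsetP[u /priv[h1 h2] ->].
apply: leq_trans (subset_leq_card sub); rewrite cardsU.
rewrite (_ : _ :&: _ = set0); last first.
  apply/setP => z; rewrite !inE; apply/negP => /andP[/imsetP[u uT ->] /imsetP[w wT [E _]]].
  by move: pT; rewrite E wT.
by rewrite cards0 !card_imset ?cT // => a b [].
Qed.

(** Every other clique on [xy] meets [Q] in one of the two triangles of [Q] through [xy]. Among
    three others, two share their triangle, and [page_edges_private] applies. *)
Lemma crowded_edge_private (V : finType) (F : {set {set V}}) (Q : {set V}) x y :
  no_2_overlap F -> (forall Q, Q \in F -> #|Q| = 4) ->
  Q \in F -> x \in Q -> y \in Q -> x != y ->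
  3 < #|[set Q' in F | (x \in Q') && (y \in Q')]| -> 6 <= #|private_pairs F Q|.
Proof.
move=> ov F4 QF xQ yQ xy; set K := [set Q' in F | _] => K4.
have QK : Q \in K by rewrite inE QF xQ yQ.
have c3 Q' : Q' \in K :\ Q -> #|Q :&: Q'| = 3.
  rewrite !inE => /and3P[nQ Q'F /andP[xQ' yQ']].
  by apply: (overlap_pair_card3 ov F4 QF Q'F _ xy) => //; rewrite eq_sym.
case: (boolP [exists Q1 in K :\ Q, exists Q2 in K :\ Q,
    (Q1 != Q2) && (Q :&: Q1 == Q :&: Q2)]).
  case/exists_inP => Q1 h1 /exists_inP[Q2 h2 /andP[n12 /eqP E]].
  move: (h1) (h2); rewrite !inE => /and3P[n1 F1 _] /and3P[n2 F2 _].
  exact: (page_edges_private ov F4 QF F1 F2 n1 n2 n12 erefl (esym E) (c3 _ h1)).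
move/exists_inPn => none.
(* Otherwise the at least three other cliques on xy would miss distinct
   vertices of Q other than x and y, and there are only two of those. *)
have inj : {in K :\ Q &, injective (fun Q' => Q :\: Q')}.
  move=> Q1 Q2 h1 h2 E; apply/eqP; apply: contraNT (none Q1 h1) => n12.
  apply/exists_inP; exists Q2 => //; rewrite n12 /=.
  have capE Q' : Q :&: Q' = Q :\: (Q :\: Q') by rewrite setDDr setDv set0U.
  by rewrite !capE E.
have sub : (fun Q' => Q :\: Q') @: (K :\ Q) \subset set1 @: (Q :\ x :\ y).
  apply/subsetP => Z /imsetP[Q' h ->].
  have /cards1P[z Ez] : #|Q :\: Q'| == 1.
    by have := cardsID Q' Q; rewrite c3 // (F4 Q QF) -[4]/(3 + 1) => /addnI ->.
  apply/imsetP; exists z; rewrite ?Ez //.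
  have : z \in Q :\: Q' by rewrite Ez inE.
  rewrite !inE => /andP[zQ' ->]; rewrite andbT; move: h; rewrite !inE.
  case/and3P => _ _ /andP[xQ' yQ'].
  by apply/andP; split; apply: contraNneq zQ' => ->.
have := subset_leq_card sub; rewrite (card_in_imset inj).
have := leq_imset_card set1 (Q :\ x :\ y).
have yQx : y \in Q :\ x by rewrite !inE eq_sym xy yQ.
rewrite (cardsD1_pred QK) (cardsD1_pred yQx) (cardsD1_pred xQ).
rewrite (F4 _ QF) => h1 h2; have := leq_trans h2 h1.
by move: K4; case: #|K| => [|[|[|[|k]]]].
Qed.

(** Cliques with three private edges (six ordered pairs) are paid for by those edges. Any other
    clique contains a pair of [D], and that pair lies in at most three cliques. *)
Lemma card_cliques4_le (V : finType) (e : rel V) (D : {set V * V}) :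
  no_2_overlap (cliques4 e) ->
  (forall A, A \in cliques4 e ->
    exists x y, [/\ x \in A, y \in A, x != y & (x, y) \in D]) ->
  6 * #|cliques4 e| <= 18 * #|D| + edges_between e setT setT.
Proof.
move=> ov hit; set F := cliques4 e in ov *.
have F4 Q : Q \in F -> #|Q| = 4 by apply: cliques4_card.
pose L := [set Q in F | 6 <= #|private_pairs F Q|].
have L_le : 6 * #|L| <= edges_between e setT setT.
  apply: (@leq_trans (\sum_(Q in L) #|private_pairs F Q|)).
    rewrite mulnC -sum_nat_const; apply: leq_sum => Q.
    by rewrite inE => /andP[].
  under eq_bigr => Q _ do rewrite -sum1_card.
  rewrite (exchange_big_dep predT) //=.
  rewrite /edges_between -sum1_card [X in _ <= X]big_mkcond /=.
  apply: leq_sum => p _.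
  rewrite (eq_bigl [in [set Q in L | p \in private_pairs F Q]]); last first.
    by move=> Q; rewrite [in RHS]inE.
  rewrite sum1_card.
  (* A pair is private to at most one clique, and it is then an edge. *)
  have [->|[Q]] := set_0Vmem [set Q in L | p \in private_pairs F Q]; first by rewrite cards0.
  rewrite inE => /andP[QL pQ].
  have QF : Q \in F by move: QL; rewrite inE => /andP[].
  have -> : p \in [set p in setX setT setT | e p.1 p.2].
    move: pQ; rewrite !inE => /and4P[h1 h2 h3 _].
    by rewrite (cliques4_adj QF h1 h2 h3).
  rewrite -(cards1 Q) subset_leq_card //; apply/subsetP => Q'.
  rewrite inE => /andP[_]; rewrite /private_pairs in_set => /and4P[_ _ _ /forall_inP h].
  rewrite in_set1 eq_sym; have := h Q QF.
  by move: pQ; rewrite inE => /and4P[-> -> _ _].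
have rest : #|F :\: L| <= 3 * #|D|.
  pose G p := [set Q in F | [&& p.1 \in Q, p.2 \in Q, p.1 != p.2 & Q \notin L]].
  apply: (@leq_trans #|\bigcup_(p in D) G p|).
    apply/subset_leq_card/subsetP => Q; rewrite inE => /andP[QL QF].
    have [x [y [xQ yQ xy xyD]]] := hit Q QF.
    apply/bigcupP; exists (x, y) => //; by rewrite inE QF xQ yQ xy QL.
  apply: leq_trans (_ : \sum_(p in D) #|G p| <= _).
    elim/big_ind2 : _ => [|A a B b hA hB|//]; first by rewrite cards0.
    by apply: leq_trans (leq_card_setU _ _).1 _; apply: leq_add.
  rewrite mulnC -sum_nat_const; apply: leq_sum => -[x y] _.
  have [->|[Q]] := set_0Vmem (G (x, y)); first by rewrite cards0.
  rewrite inE /= => /and5P[QF xQ yQ xy QL].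
  apply: (@leq_trans #|[set Q' in F | (x \in Q') && (y \in Q')]|).
    apply/subset_leq_card/subsetP => Q'; rewrite !inE /=.
    by case/andP => -> /and4P[-> ->].
  rewrite leqNgt; apply: contra QL => h; rewrite inE QF.
  exact: (crowded_edge_private ov F4 QF xQ yQ xy h).
have := cardsID L F; have : #|F :&: L| <= #|L| by rewrite subset_leq_card ?subsetIr.
lia.
Qed.

(** Deleting [D] leaves a K_4-free graph, so three times the edge count is at most
    [2 * #|V| ^ 2 + 3 * #|D|]. Tripling [card_cliques4_le] gives the coefficient [57 = 54 + 3] of
    [#|D|], and [57 / 18] times [eps / 4] is below [eps]. *)
Lemma cliques4_upper (R : archiRealFieldType) (eps : R) :
  (0 < eps)%R ->
  exists N : nat, forall (V : finType) (e : rel V),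
    N <= #|V| -> symmetric e -> irreflexive e -> no_2_overlap (cliques4 e) ->
    (#|cliques4 e|%:R <= #|V|%:R ^+ 2 / 9 + eps * #|V|%:R ^+ 2)%R.
Proof.
move=> eps0; have eps4 : (0 < eps / 4)%R by lra.
have [N HN] := K4_hitting_set eps4; exists N => V e hN sym irr ov.
have [D [D_le Dsym hit]] := HN V e hN sym irr ov.
pose e' x y := e x y && ((x, y) \notin D).
have sym' : symmetric e' by move=> x y; rewrite /e' sym Dsym.
have irr' : irreflexive e' by move=> x; rewrite /e' irr.
have sub x y : e' x y -> e x y by case/andP.
have free a b c d : e' a b -> e' a c -> e' a d -> e' b c -> e' b d -> e' c d -> False.
  move=> ab ac ad bc bd cd.
  have := hit _ (cliques4_quad sym irr (sub _ _ ab) (sub _ _ ac) (sub _ _ ad)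
    (sub _ _ bc) (sub _ _ bd) (sub _ _ cd)).
  case=> x [y [xQ yQ xy xyD]].
  have := cliques4_adj (cliques4_quad sym' irr' ab ac ad bc bd cd) xQ yQ xy.
  by rewrite /e' xyD andbF.
have he : edges_between e setT setT <= edges_between e' setT setT + #|D|.
  apply: leq_trans (leq_card_setU _ _).1.
  apply/subset_leq_card/subsetP => -[x y]; rewrite !inE /= /e' => ->.
  by case: (_ \in D).
have : 18 * #|cliques4 e| <= 57 * #|D| + 2 * #|V| ^ 2.
  have := turan_K4_free sym' free; have := card_cliques4_le ov hit; lia.
have : (0 <= eps * #|V|%:R ^+ 2)%R by rewrite mulr_ge0 ?sqr_ge0 // ltW.
rewrite -(ler_nat R) natrD (natrM _ 18) (natrM _ 57) (natrM _ 2) natrX; lra.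
Qed.

(** * From subgraph copies to 4-cliques *)

Definition adj (V : finType) (G : sgraph V) : rel V :=
  fun x y => [set x; y] \in edges G.

Lemma adj_sym (V : finType) (G : sgraph V) : symmetric (adj G).
Proof. by move=> x y; rewrite /adj setUC. Qed.

Lemma edge_card2 (V : finType) (G : sgraph V) (e : {set V}) :
  e \in edges G -> #|e| = 2.
Proof. by move=> h; apply/eqP; apply: (forall_inP (edgesP G)). Qed.

Lemma adj_irr (V : finType) (G : sgraph V) : irreflexive (adj G).
Proof.
by move=> x; apply/negP => /edge_card2; rewrite setUid cards1.
Qed.

Lemma cliques4_adjE (V : finType) (G : sgraph V) (A : {set V}) :
  (A \in cliques4 (adj G)) = (#|A| == 4) && (clique_edges A \subset edges G).
Proof.
rewrite inE; congr (_ && _); apply/forall_inP/subsetP => [h e|h x xA].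
  rewrite inE => /andP[eA /cards2P[x [y [xy E]]]]; move: eA.
  rewrite E subUset !sub1set => /andP[xA yA].
  by have /forall_inP/(_ y yA)/implyP/(_ xy) := h x xA.
apply/forall_inP => y yA; apply/implyP => xy; apply: h.
by rewrite inE subUset !sub1set xA yA cards2 xy.
Qed.

Lemma edge_image_clique (U V : finType) (f : U -> V) (A : {set U}) :
  injective f -> edge_image f (clique_on A) = clique_edges (f @: A).
Proof.
move=> inj; apply/setP => e; apply/imsetP/idP => [[d + ->]|].
  by rewrite !inE card_imset // => /andP[/imsetS -> ->].
rewrite inE => /andP[eA /cards2P[x [y [xy E]]]].
move: eA; rewrite E subUset !sub1set => /andP[/imsetP[a aA Ex] /imsetP[b bA Ey]].
exists [set a; b]; last by rewrite imsetU1 imset_set1 -Ex -Ey.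
rewrite inE subUset !sub1set aA bA cards2.
by rewrite (_ : a != b) //; apply: contraNneq xy => ab; rewrite Ex Ey ab.
Qed.

Definition nth_ffun (V : finType) (n : nat) (x0 : V) (s : seq V) : {ffun 'I_n -> V} :=
  [ffun i : 'I_n => nth x0 s i].

Lemma nth_ffun_inj (V : finType) (n : nat) (x0 : V) (s : seq V) :
  size s = n -> uniq s -> injective (nth_ffun n x0 s).
Proof.
move=> sn us i j; rewrite !ffunE => /eqP.
by rewrite nth_uniq ?sn // => /eqP/val_inj.
Qed.

(** The edge set of a copy of K_4 is determined by its vertex set, so copies may be counted as
    cliques. *)
Lemma copies_K4E (V : finType) (G : sgraph V) :
  copies K4 G = [set (A, clique_edges A) | A in cliques4 (adj G)].
Proof.
apply/setP => c; apply/imsetP/imsetP => [[f]|[A]].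
  rewrite inE => /andP[/injectiveP inj sub] ->; exists (f @: [set: 'I_4]); last first.
    by rewrite -edge_image_clique.
  by rewrite cliques4_adjE card_imset // cardsT card_ord eqxx -edge_image_clique.
rewrite cliques4_adjE => /andP[/eqP A4 sub] ->.
have [a [b [c1 [d [us EA]]]]] := card4_quad A4.
pose f : {ffun 'I_4 -> V} := nth_ffun 4 a [:: a; b; c1; d].
have inj : injective f by exact: nth_ffun_inj.
have fA : f @: [set: 'I_4] = A.
  apply/eqP; rewrite eqEcard card_imset // cardsT card_ord A4 andbT.
  apply/subsetP => _ /imsetP[i _ ->]; rewrite ffunE EA.
  have := mem_nth a (ltn_ord i : i < size [:: a; b; c1; d]).
  by rewrite !inE -!orbA.
have E : edge_image f K4 = clique_edges A by rewrite -fA -edge_image_clique.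
exists f; last by rewrite fA E.
by rewrite inE E sub andbT; apply/injectiveP.
Qed.

Lemma card_copies_K4 (V : finType) (G : sgraph V) :
  #|copies K4 G| = #|cliques4 (adj G)|.
Proof. by rewrite copies_K4E card_imset // => A B []. Qed.

Lemma edge_image_B42 (V : finType) (f : 'I_6 -> V) :
  injective f ->
  edge_image f B42 = clique_edges (f @: [set i : 'I_6 | i < 4])
                     :|: clique_edges (f @: [set i : 'I_6 | 2 <= i]).
Proof. by move=> inj; rewrite -!edge_image_clique // -imsetU. Qed.

(** An embedding of [B42] and two 4-cliques sharing exactly two vertices are the same data, up to
    labelling. *)
Lemma B42_freeE (V : finType) (G : sgraph V) :
  graph_free B42 G = no_2_overlap (cliques4 (adj G)).
Proof.
apply/idP/idP => [free|ov].
  apply/forall_inP => A; rewrite cliques4_adjE => /andP[/eqP A4 subA].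
  apply/forall_inP => B; rewrite cliques4_adjE => /andP[/eqP B4 subB].
  apply/negP => AB2; move: (AB2) => /cards2P[u [v [uv EI]]].
  have : #|A :\: B| == 2.
    by have := cardsID B A; rewrite (eqP AB2) A4 -[4]/(2 + 2) => /addnI ->.
  case/cards2P => a [b [ab EA]].
  have : #|B :\: A| == 2.
    by have := cardsID A B; rewrite setIC (eqP AB2) B4 -[4]/(2 + 2) => /addnI ->.
  case/cards2P => c [d [cd EB]].
  have EA' : A = [set a; b; u; v] by rewrite -(setID A B) EI EA setUC setUA.
  have EB' : B = [set u; v; c; d] by rewrite -(setID B A) setIC EI EB setUA.
  have /andP[aA aB] : (a \in A) && (a \notin B) by rewrite andbC -in_setD EA !inE eqxx.
  have /andP[bA bB] : (b \in A) && (b \notin B) by rewrite andbC -in_setD EA !inE eqxx orbT.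
  have /andP[cB cA] : (c \in B) && (c \notin A) by rewrite andbC -in_setD EB !inE eqxx.
  have /andP[dB dA] : (d \in B) && (d \notin A) by rewrite andbC -in_setD EB !inE eqxx orbT.
  have us : uniq [:: a; b; u; v; c; d].
    move: aB bB cA dA; rewrite EA' EB' /= !inE !negb_or -!andbA.
    move=> /and4P[-> -> ac ad] /and4P[-> -> bc bd].
    move=> /and4P[_ _ cu cv] /and4P[_ _ du dv].
    by rewrite ab ac ad bc bd uv cd !(eq_sym u) !(eq_sym v) cu cv du dv.
  (* The common vertices [u], [v] take positions 2 and 3, so that [A] occupies 0 to 3 and [B]
     occupies 2 to 5. *)
  pose f : {ffun 'I_6 -> V} := nth_ffun 6 a [:: a; b; u; v; c; d].
  have inj : injective f by exact: nth_ffun_inj.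
  have fA : f @: [set i : 'I_6 | i < 4] \subset A.
    apply/subsetP => _ /imsetP[i + ->]; rewrite inE ffunE EA'.
    by case: i => -[|[|[|[|[]]]]] //= *; rewrite !inE eqxx ?orbT.
  have fB : f @: [set i : 'I_6 | 2 <= i] \subset B.
    apply/subsetP => _ /imsetP[i + ->]; rewrite inE ffunE EB'.
    by case: i => -[|[|[|[|[|[]]]]]] //= *; rewrite !inE eqxx ?orbT.
  have mono (S T : {set V}) : S \subset T -> clique_edges S \subset clique_edges T.
    by move=> ST; apply/subsetP => e; rewrite !inE => /andP[eS ->]; rewrite (subset_trans eS).
  have /eqP/setP/(_ (f @: [set: 'I_6], edge_image f B42)) := free.
  rewrite in_set0 => /negP[]; apply: imset_f; rewrite inE.
  apply/andP; split; first exact/injectiveP.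
  rewrite edge_image_B42 // subUset.
  by rewrite (subset_trans (mono _ _ fA)) // (subset_trans (mono _ _ fB)).
apply/eqP/setP => c; rewrite in_set0; apply/negP => /imsetP[f].
rewrite inE => /andP[/injectiveP inj]; rewrite edge_image_B42 // subUset.
case/andP => subA subB _.
have card_ord6 (P : pred 'I_6) : #|[set i : 'I_6 | P i]| = \sum_(i < 6) P i.
  by rewrite -sum1dep_card big_mkcond; apply: eq_bigr => i _; case: (P i).
have hA : f @: [set i : 'I_6 | i < 4] \in cliques4 (adj G).
  by rewrite cliques4_adjE subA card_imset // card_ord6 !big_ord_recl big_ord0.
have hB : f @: [set i : 'I_6 | 2 <= i] \in cliques4 (adj G).
  by rewrite cliques4_adjE subB card_imset // card_ord6 !big_ord_recl big_ord0.
case: (no_2_overlapP ov hA hB); rewrite -imsetI; last by move=> ? ? _ _ /inj.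
rewrite card_imset //.
rewrite (_ : _ :&: _ = [set i : 'I_6 | (i < 4) && (2 <= i)]).
  by rewrite card_ord6 !big_ord_recl big_ord0.
by apply/setP => i; rewrite !inE.
Qed.

(** * The construction for the lower bound *)

Lemma graph_of_relP (V : finType) (r : rel V) :
  [forall e in [set [set p.1; p.2] | p : V * V & (p.1 != p.2) && r p.1 p.2], #|e| == 2].
Proof.
apply/forall_inP => e /imsetP[p]; rewrite inE => /andP[ne _] ->.
by rewrite cards2 ne.
Qed.

Definition graph_of_rel (V : finType) (r : rel V) : sgraph V :=
  SGraph (graph_of_relP r).

Lemma adj_graph_of_rel (V : finType) (r : rel V) (x y : V) :
  symmetric r -> adj (graph_of_rel r) x y = (x != y) && r x y.
Proof.
move=> sym; apply/imsetP/idP => [[[u v]]|h]; last by exists (x, y); rewrite ?inE.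
rewrite inE /= => /andP[uv ruv] E.
have xy : x != y by have := cards2 x y; rewrite E cards2 uv; case: eqP.
have : x \in [set u; v] by rewrite -E !inE eqxx.
have : y \in [set u; v] by rewrite -E !inE eqxx orbT.
rewrite xy !inE => /orP[] /eqP yE /orP[] /eqP xE; move: xy; rewrite xE yE ?eqxx //.
by rewrite sym.
Qed.

(** [inl (j, i)] is corner [i] of triangle [j], and [inr] marks the independent set. The relation is
    reflexive on the left summand; [graph_of_rel] drops the loops. *)
Definition join_rel (k m : nat) (x y : 'I_k * 'I_3 + 'I_m) : bool :=
  match x, y with
  | inl p, inl q => p.1 == q.1
  | inr _, inr _ => false
  | _, _ => true
  end.

(** A 4-clique has at most one independent vertex, and its other vertices lie in one triangle, so it
    is a triangle plus one vertex. Two such cliques share at least the triangle, or at most one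
    vertex. *)
Lemma join_graph_bound (V : finType) (k m : nat) :
  #|V| = k * 3 + m ->
  exists G : sgraph V, graph_free B42 G && (k * m <= #|copies K4 G|).
Proof.
move=> cV; have cT : #|V| = #|{: 'I_k * 'I_3 + 'I_m}|.
  by rewrite card_sum card_prod !card_ord.
pose g (x : V) : 'I_k * 'I_3 + 'I_m := enum_val (cast_ord cT (enum_rank x)).
pose h (z : 'I_k * 'I_3 + 'I_m) : V := enum_val (cast_ord (esym cT) (enum_rank z)).
have gK : cancel g h by move=> x; rewrite /g /h enum_valK cast_ordK enum_rankK.
have hK : cancel h g by move=> x; rewrite /g /h enum_valK cast_ordKV enum_rankK.
pose r x y := join_rel (g x) (g y).
have symr : symmetric r.
  by move=> x y; rewrite /r; case: (g x) (g y) => [p|?] [q|?] //=; rewrite eq_sym.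
pose G := graph_of_rel r; exists G.
rewrite B42_freeE card_copies_K4.
pose tri j : {set V} := [set h (inl (j, i)) | i : 'I_3].
have h_inj := can_inj hK.
have tri3 j : #|tri j| = 3 by rewrite card_imset ?cardsT ?card_ord // => i i' /h_inj [].
pose C j a := h (inr a) |: tri j.
have inr_tri a j : h (inr a) \notin tri j.
  by apply/imsetP => -[i _ /h_inj].
have C4 j a : C j a \in cliques4 (adj G).
  rewrite inE cardsU1 inr_tri tri3 /=.
  apply/forall_inP => x xC; apply/forall_inP => y yC; apply/implyP => xy.
  rewrite adj_graph_of_rel // xy /=; move: xC yC xy; rewrite !inE /r.
  case/orP => [/eqP ->|/imsetP[i _ ->]]; case/orP => [/eqP ->|/imsetP[i' _ ->]];
    by rewrite !hK //= eqxx.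
have CP Q : Q \in cliques4 (adj G) -> exists j a, Q = C j a.
  move=> QF; have Q4 := cliques4_card QF.
  have adjQ x y : x \in Q -> y \in Q -> x != y -> r x y.
    by move=> xQ yQ xy; have := cliques4_adj QF xQ yQ xy; rewrite adj_graph_of_rel // xy.
  pose low := [set x | if g x is inl _ then true else false].
  have high1 : #|Q :\: low| <= 1.
    apply/card_le1_eqP => x y; rewrite !inE => /andP[lx xQ] /andP[ly yQ].
    apply/eqP; apply: contraTT isT => xy; have := adjQ y x yQ xQ xy; move: lx ly.
    by rewrite /r; case: (g x) (g y) => [?|?] [?|?].
  have low3 : 3 <= #|Q :&: low|.
    by move: high1; rewrite -(leq_add2l #|Q :&: low|) cardsID Q4 addn1.
  have /card_gt0P[x] : 0 < #|Q :&: low| by apply: leq_trans low3.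
  rewrite !inE; case gx : (g x) => [[j i]|?] /andP[xQ]; last by [].
  move=> _.
  have lowT : Q :&: low \subset tri j.
    apply/subsetP => y; rewrite !inE => /andP[yQ].
    case gy : (g y) => [[j' i']|//] _; have -> : j = j'.
      have [xy|xy] := eqVneq x y; first by move: gx; rewrite xy gy => -[].
      by have := adjQ x y xQ yQ xy; rewrite /r gx gy => /eqP.
    by apply/imsetP; exists i'; rewrite // -(gK y) gy.
  have lowE : Q :&: low = tri j by apply/eqP; rewrite eqEcard lowT tri3.
  have : #|Q :\: low| == 1.
    by have := cardsID low Q; rewrite lowE tri3 Q4 -[4]/(3 + 1) => /addnI ->.
  case/cards1P => z Ez; have : z \in Q :\: low by rewrite Ez set11.
  rewrite !inE; case gz : (g z) => [q|a] /=; first by [].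
  by exists j, a; rewrite /C -gz gK -Ez -lowE setUC setID.
apply/andP; split.
  apply/forall_inP => Q /CP[j [a ->]]; apply/forall_inP => Q' /CP[j' [a' ->]].
  have [<-|jj] := eqVneq j j'.
    have : tri j \subset C j a :&: C j a' by rewrite subsetI !subsetUr.
    by move/subset_leq_card; rewrite tri3; case: eqP => // ->.
  have : C j a :&: C j' a' \subset [set h (inr a)].
    apply/subsetP => x; rewrite !inE => /andP[/orP[//|/imsetP[i _ ->]]].
    case/orP => [/eqP/h_inj //|/imsetP[i' _ /h_inj [E _]]].
    by rewrite E eqxx in jj.
  by move/subset_leq_card; rewrite cards1; case: eqP => // ->.
have Cinj : injective (fun p : 'I_k * 'I_m => C p.1 p.2).
  move=> [j a] [j' a'] /= E.
  have : h (inr a) \in C j' a' by rewrite -E setU11.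
  rewrite !inE => /orP[/eqP/h_inj [->]|]; last by rewrite (negbTE (inr_tri _ _)).
  have : h (inl (j, ord0)) \in C j' a'.
    by rewrite -E setU1r //; apply/imsetP; exists ord0.
  by rewrite !inE => /orP[/eqP/h_inj //|/imsetP[i _ /h_inj [-> _]]].
rewrite -{1}(card_ord k) -{1}(card_ord m) -card_prod -(card_codom Cinj).
by apply/subset_leq_card/subsetP => _ /codomP[[j a] ->]; apply: C4.
Qed.

(** * The two bounds on the extremal number *)

Lemma ex_K4_B42_lower (n : nat) : 2 < n -> n ^ 2 <= 12 * ex n K4 B42 + 24.
Proof.
(* [k (n - 3 k)] peaks at [n / 6], and [k] is a nearest integer to it; [2 < n] ensures [3 k <= n].
   As [n ^ 2 = 12 k (n - 3 k) + (n - 6 k) ^ 2], the loss is at most 9. *)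
move=> n2; pose k := (n + 3) %/ 6.
have cn : #|'I_n| = k * 3 + (n - k * 3) by rewrite card_ord /k; lia.
have [G /andP[free bound]] := join_graph_bound cn.
have h := @leq_bigmax_cond _ (fun G : sgraph 'I_n => graph_free B42 G)
  (fun G => #|copies K4 G|) G free.
rewrite -/(ex n K4 B42) in h.
have : n ^ 2 <= 12 * (k * (n - k * 3)) + 24.
  have [s [hs En]] : exists s, s < 6 /\ n + 3 = 6 * k + s.
    by exists ((n + 3) %% 6); rewrite /k; split; lia.
  clear -hs En n2; nia.
move=> h1; have := leq_trans bound h; lia.
Qed.

Lemma ex_K4_B42_upper (R : archiRealFieldType) (eps : R) :
  (0 < eps)%R -> exists N : nat, forall n, N <= n ->
    ((ex n K4 B42)%:R <= n%:R ^+ 2 / 9 + eps * n%:R ^+ 2)%R.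
Proof.
move=> eps0; have [N HN] := cliques4_upper eps0; exists N => n hn.
rewrite /ex; elim/big_ind : _ => [|a b ha hb|G].
- by rewrite addr_ge0 // ?divr_ge0 ?mulr_ge0 ?sqr_ge0 ?(ltW eps0) // ler0n.
- by case: (leqP a b).
rewrite B42_freeE card_copies_K4 => ov.
have := HN 'I_n (adj G); rewrite card_ord; apply => //.
- exact: adj_sym.
- exact: adj_irr.
Qed.

From mathcomp Require Import all_classical all_reals all_analysis.
Import Order.TTheory GRing.Theory Num.Theory.
Import numFieldNormedType.Exports.
Local Open Scope ring_scope.
Local Open Scope classical_set_scope.

Theorem theorem1p7 (R : realType) :
  (\forall n \near \oo, n%:R ^+ 2 / 12%:R - 2%:R <= (ex n K4 B42)%:R :> R) /\
  (exists2 h : nat -> R,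
     h =o_\oo (fun n : nat => n%:R ^+ 2 : R) &
     forall n : nat, (ex n K4 B42)%:R <= n%:R ^+ 2 / 9%:R + h n).
Proof.
split.
  near=> n.
  have n2 : (2 < n)%N by near: n; exact: nbhs_infty_gt.
  have := ex_K4_B42_lower n2.
  rewrite -(ler_nat R) natrX natrD (natrM _ 12); lra.
(* Taking the positive part of the excess gives a bound valid for every [n] and leaves only an upper
   estimate for the little-o. *)
pose h (n : nat) : R := Num.max 0 ((ex n K4 B42)%:R - n%:R ^+ 2 / 9%:R).
exists h; last first.
  by move=> n; rewrite -lerBlDl /h le_max lexx orbT.
apply/eqoP => eps eps0; have [N HN] := ex_K4_B42_upper eps0.
near=> n.
have hn : (N <= n)%N by near: n; exact: nbhs_infty_ge.
rewrite ger0_norm ?le_max ?lexx // ger0_norm ?sqr_ge0 // ge_max.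
rewrite mulr_ge0 ?sqr_ge0 ?(ltW eps0) //= lerBlDl.
exact: HN.
Unshelve. all: by end_near.
Qed.
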